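(* Let $f:\mathbb{H}^2\to\mathbb{H}^2$ be a bijection that sends horocycles to horocycles, i.e. for every horocycle $h\subset\mathbb{H}^2$ the image $f(h)$ is a horocycle. Then $f$ is an isometry of $\mathbb{H}^2$.
   Context: $\mathbb{H}^2=\{z\in\mathbb{C}:\mathrm{Im}(z)>0\}$ is the hyperbolic plane (upper half-plane model), with boundary $\partial\mathbb{H}^2=\mathbb{R}\cup\{\infty\}$. A horocycle is a curve in $\mathbb{H}^2$ that is either a Euclidean circle tangent to $\mathbb{R}$ at a point $x$, with the tangency point $x$ removed (horocycle centered at $x$), or a horizontal line $\{\mathrm{Im}(z)=c\}$, $c>0$ (horocycle centered at $\infty$). Equivalently, it is a complete curve of constant geodesic curvature $1$. Isometries may preserve or reverse orientation. No continuity of $f$ is assumed. *)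

(* Defs.v *)
From mathcomp Require Import all_boot all_order all_algebra.
From mathcomp Require Import complex.
From mathcomp Require Import all_classical all_reals all_analysis.

Set Implicit Arguments.
Unset Strict Implicit.
Unset Printing Implicit Defensive.

Import Order.TTheory GRing.Theory Num.Theory.

Local Open Scope classical_set_scope.
Local Open Scope ring_scope.
Local Open Scope complex_scope.

Definition H2 (R : realType) : Type := {z : R[i] | 0 < complex.Im z}.

(* Only used at x >= 1, where it is the inverse of cosh on [0, +oo[. *)
Definition arcosh (R : realType) (x : R) : R := ln (x + Num.sqrt (x ^+ 2 - 1)).

(* The distance of the Riemannian metric (dx^2 + dy^2) / y^2, in closed form. *)
Definition hdist (R : realType) (z w : H2 R) : R :=
  arcosh (1 + ComplexField.Normc.normc (val z - val w) ^+ 2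
              / (2 * complex.Im (val z) * complex.Im (val w))).

(* Both orientation-preserving and orientation-reversing maps are allowed. *)
Definition H2_isometry (R : realType) (f : H2 R -> H2 R) : Prop :=
  bijective f /\ forall z w : H2 R, hdist (f z) (f w) = hdist z w.

Definition euclidean_circle (R : realType) (c : R[i]) (r : R) : set R[i] :=
  [set z | ComplexField.Normc.normc (z - c) = r].

(* A circle of radius r that meets H2 and is tangent to the real line at x has
   center x + i r; restricting it to H2 removes exactly the tangency point. *)
Definition horocycle_at (R : realType) (x r : R) : set (H2 R) :=
  [set z | euclidean_circle (x +i* r) r (val z)].

Definition horocycle_at_infty (R : realType) (c : R) : set (H2 R) :=
  [set z | complex.Im (val z) = c].

Definition horocycle (R : realType) (h : set (H2 R)) : Prop :=
  (exists x r : R, 0 < r /\ h = horocycle_at x r) \/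
  (exists c : R, 0 < c /\ h = horocycle_at_infty c).

(* Main.v *)
Require Import Defs.
From mathcomp Require Import all_boot all_order all_algebra.
From mathcomp Require Import complex.
From mathcomp Require Import all_classical all_reals all_analysis.
From mathcomp Require Import ring lra.

Local Open Scope classical_set_scope.

(** Every horocycle is the locus (p x - q)^2 + (p y)^2 = y for a nonzero vector
    (p, q), unique up to sign: its center is q / p and its Euclidean
    diameter 1 / p^2, or, if p = 0, its center is infinity and its height q^2.
    For two such vectors with determinant D, the horocycles have exactly one
    common point iff D^2 = 1 ([tangentP]), and D = 0 iff they have the same
    center. Two independent vectors u, v always admit a vector k with
    det(k, u) = det(k, v) = 1, whereas no vector has determinant 1 or -1 with
    both of two proportional vectors, unless these are equal or opposite. So two
    distinct horocycles have the same center iff no horocycle is tangent to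
    both ([cotangentP]), which describes concentricity by incidence alone.

    Tangency is preserved by f and by its inverse because f is injective. To
    transport the absence of a common tangent one needs every horocycle to be
    the image of a horocycle. This holds because two distinct points lie on
    exactly two horocycles ([horo_through_two], [no_third_horo]): given a
    horocycle k and two of its points, the two horocycles through their
    preimages are sent to two horocycles through these points, and k must be
    one of them ([horocycle_preimage]). Hence f permutes the centers
    ([concentric_image]).

    After composing with an inversion, f sends horizontal lines to horizontal
    lines. A point is the tangency point of the horizontal line through it with
    the circle below it, so f (x + i y) = phi x + i psi y, where phi is the
    action of f on the centers. Circles with centers x, x' and diameters d, d'
    are tangent iff (x - x')^2 = d d', a relation which phi and psi therefore
    respect. It forces phi to be affine and psi to be linear with the same
    ratio ([scaling_distances_affine]): phi preserves midpoints, so after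
    normalization it is additive, and then it commutes with squaring, so it is
    monotone. Finally, (x, y) |-> (a x + b, |a| y) preserves the distance. *)

Section HalfPlane.
Set Implicit Arguments.
Unset Strict Implicit.
Unset Printing Implicit Defensive.
Import Order.TTheory GRing.Theory Num.Theory.
Local Open Scope ring_scope.
Local Open Scope complex_scope.
Variable R : realType.
Implicit Types (x y p q : R) (z w : H2 R) (h k : set (H2 R)).

(** * Cartesian coordinates and horocycle vectors *)

Definition re z : R := complex.Re (val z).
Definition im z : R := complex.Im (val z).

Lemma im_gt0 z : 0 < im z.
Proof. exact: (valP z). Qed.

Lemma H2_eq z w : re z = re w -> im z = im w -> z = w.
Proof.
rewrite /re /im => ab cd; apply: val_inj; move: ab cd.
by case: (val z) => a b; case: (val w) => c d /= -> ->.
Qed.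

Definition imaginary_unit : H2 R :=
  exist (fun z : R[i] => 0 < complex.Im z) (0 +i* 1) ltr01.

Definition point x y : H2 R := insubd imaginary_unit (x +i* y).

Lemma re_point x y : 0 < y -> re (point x y) = x.
Proof. by move=> y0; rewrite /re insubdK. Qed.

Lemma im_point x y : 0 < y -> im (point x y) = y.
Proof. by move=> y0; rewrite /im insubdK. Qed.

Lemma normc_sqr (a b : R) :
  ComplexField.Normc.normc (a +i* b) ^+ 2 = a ^+ 2 + b ^+ 2.
Proof. by rewrite /= sqr_sqrtr// addr_ge0 ?sqr_ge0. Qed.

Lemma hdistE z w :
  hdist z w = arcosh (1 + ((re z - re w) ^+ 2 + (im z - im w) ^+ 2)
                          / (2 * im z * im w)).
Proof.
rewrite /hdist /re /im; case: (val z) => a b; case: (val w) => c d.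
by rewrite normc_sqr.
Qed.

(** Writing z = x + i y, the equation reads |p z - q|^2 = y. This form treats
    circles (p != 0) and horizontal lines (p = 0) alike, and a real Moebius
    transformation of determinant 1 acts on the vectors (p, q) linearly. *)
Definition horo p q : set (H2 R) :=
  [set z | (p * re z - q) ^+ 2 + (p * im z) ^+ 2 = im z].

Lemma horocycle_atE x r : 0 < r ->
  horocycle_at x r = horo (Num.sqrt (2 * r))^-1 (x / Num.sqrt (2 * r)).
Proof.
move=> r0; apply/seteqP.
have s0 : 0 < Num.sqrt (2 * r) by rewrite sqrtr_gt0; lra.
have s2 : Num.sqrt (2 * r) ^+ 2 = 2 * r by rewrite sqr_sqrtr; lra.
have E z : horocycle_at x r z <-> (re z - x) ^+ 2 + (im z - r) ^+ 2 = r ^+ 2.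
  rewrite /horocycle_at /euclidean_circle /re /im /=.
  case: (val z) => a b; set n := ComplexField.Normc.normc _.
  have n0 : 0 <= n by rewrite /n /= sqrtr_ge0.
  have <- : n ^+ 2 = (a - x) ^+ 2 + (b - r) ^+ 2 by rewrite normc_sqr.
  split=> [-> //|/eqP]; rewrite eqrXn2 ?(ltW r0)// => /eqP //.
set s := Num.sqrt _ in s0 s2 *.
have F z : horo s^-1 (x / s) z <-> (re z - x) ^+ 2 + im z ^+ 2 = 2 * r * im z.
  have -> : horo s^-1 (x / s) z =
     (((re z - x) ^+ 2 + im z ^+ 2) / (2 * r) = im z).
    by rewrite /horo /= -s2; congr (_ = _); field; lra.
  split=> [e|->]; last by field; lra.
  by rewrite -[X in _ = _ * X]e; field; lra.
split=> z; [move/E => e; apply/F|move/F => e; apply/E]; lra.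
Qed.

Lemma horo_infE q : horo 0 q = horocycle_at_infty (q ^+ 2).
Proof.
apply/seteqP; split=> z; rewrite /horo /horocycle_at_infty /= -/(im z); lra.
Qed.

Lemma horocycleP h :
  horocycle h <-> exists p q, (p, q) != (0, 0) /\ h = horo p q.
Proof.
split=> [[[x [r [r0 ->]]]|[c [c0 ->]]]|[p [q [pq ->]]]].
- exists (Num.sqrt (2 * r))^-1, (x / Num.sqrt (2 * r)).
  rewrite horocycle_atE//; split=> //.
  have : Num.sqrt (2 * r) != 0 by rewrite gt_eqF// sqrtr_gt0; lra.
  by rewrite -invr_eq0; apply: contraNneq => -[-> _].
- exists 0, (Num.sqrt c); rewrite horo_infE sqr_sqrtr ?ltW//; split=> //.
  have : Num.sqrt c != 0 by rewrite gt_eqF// sqrtr_gt0.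
  by apply: contraNneq => -[->].
have [p0|p0] := eqVneq p 0.
  right; exists (q ^+ 2); rewrite p0 horo_infE; split=> //.
  rewrite exprn_even_gt0//=; apply: contraNneq pq => ->; by rewrite p0.
left; exists (q / p), (2 * p ^+ 2)^-1.
have p2 : 0 < p ^+ 2 by rewrite exprn_even_gt0.
have r0 : 0 < (2 * p ^+ 2)^-1 by rewrite invr_gt0; lra.
split=> //; rewrite horocycle_atE//.
have -> : 2 * (2 * p ^+ 2)^-1 = p^-1 ^+ 2 by field.
rewrite sqrtr_sqr normfV !invrK; apply/funext => z; rewrite /horo /=.
have -> : q / p * `|p| = `|p| * (q / p) by ring.
rewrite -mulrBr !exprMn real_normK ?num_real//; congr (_ = _).
by field.
Qed.
(** * Pairs of horocycles *)

Definition det p q p' q' : R := p * q' - p' * q.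

Definition tangent h k := exists z, h `&` k = [set z].

(** Put A = p z - q and B = p' z - q'. On both horocycles |A|^2 = |B|^2 = y,
    while the imaginary part of A times the conjugate of B is - D y. So A / B
    is the unit complex number c - i D with c^2 + D^2 = 1, and z is the image
    of c - i D under the Moebius map of matrix (q', -q; p', -p). The second
    conclusion identifies c y as the real part of A times the conjugate of B,
    so that it distinguishes the common points belonging to c and - c. *)
Lemma common_pointE p q p' q' z :
  det p q p' q' != 0 -> horo p q z -> horo p' q' z ->
  exists c, let n := p ^+ 2 + p' ^+ 2 - 2 * c * p * p' in
  [/\ c ^+ 2 + det p q p' q' ^+ 2 = 1,
      (p * re z - q) * (p' * re z - q') + p * p' * im z ^+ 2 = c * im z,
      n != 0,
      re z = (p' * q' + p * q - c * (p * q' + p' * q)) / n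
    & im z = det p q p' q' ^+ 2 / n].
Proof.
move=> D0; have := im_gt0 z; rewrite /horo /=.
move: (re z) (im z) => u v v0 E1 E2.
(* Lagrange's identity |A|^2 |B|^2 = S^2 + (D y)^2, then elimination of x and y
   between the three quadratic equations. *)
set S := (p * u - q) * (p' * u - q') + p * p' * v ^+ 2.
set D := det p q p' q' in D0 *.
have SD : S ^+ 2 + (D * v) ^+ 2 = v ^+ 2.
  transitivity (((p * u - q) ^+ 2 + (p * v) ^+ 2)
                * ((p' * u - q') ^+ 2 + (p' * v) ^+ 2)); last by rewrite E1 E2.
  by rewrite /S /D /det; ring.
have vE : v * (p ^+ 2 + p' ^+ 2) - 2 * p * p' * S = D ^+ 2.
  transitivity (p ^+ 2 * ((p' * u - q') ^+ 2 + (p' * v) ^+ 2)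
     + p' ^+ 2 * ((p * u - q) ^+ 2 + (p * v) ^+ 2) - 2 * p * p' * S).
    by rewrite E1 E2; ring.
  by rewrite /S /D /det; ring.
have uE : D ^+ 2 * u = (p' * q' + p * q) * v - (p * q' + p' * q) * S.
  transitivity (p' * q' * ((p * u - q) ^+ 2 + (p * v) ^+ 2)
     + p * q * ((p' * u - q') ^+ 2 + (p' * v) ^+ 2) - (p * q' + p' * q) * S).
    by rewrite /S /D /det; ring.
  by rewrite E1 E2; ring.
clearbody S D.
have n0 : v * (p ^+ 2 + p' ^+ 2 - 2 * (S / v) * p * p') = D ^+ 2.
  by rewrite -vE; field; lra.
have D2 : D ^+ 2 != 0 by rewrite sqrf_eq0.
have n1 : p ^+ 2 + p' ^+ 2 - 2 * (S / v) * p * p' != 0.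
  by apply: contraNneq D2 => e; rewrite -n0 e mulr0.
exists (S / v); split=> //.
- apply: (mulfI (x := v ^+ 2)); first by rewrite sqrf_eq0; lra.
  by rewrite mulr1 -[RHS]SD; field; lra.
- by field; lra.
- apply: (mulfI D2); rewrite uE -[in RHS]n0; field.
  have -> : (p ^+ 2 + p' ^+ 2) * v - 2 * S * p * p' = D ^+ 2.
    by rewrite -vE; ring.
  by rewrite D2 andbT gt_eqF.
- by rewrite -n0 mulfK.
Qed.

(** The converse of [common_pointE]: each of the two solutions c, - c gives a
    common point. *)
Lemma common_point_exists p q p' q' c :
  det p q p' q' != 0 -> c ^+ 2 + det p q p' q' ^+ 2 = 1 ->
  exists z, [/\ horo p q z, horo p' q' z &
    (p * re z - q) * (p' * re z - q') + p * p' * im z ^+ 2 = c * im z].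
Proof.
set D := det p q p' q' => D0 cD.
set n := p ^+ 2 + p' ^+ 2 - 2 * c * p * p'.
(* n = |p' e - p|^2 = |p' - e p|^2 for the unit complex number e = c - i D. *)
have nE : n = (p' * c - p) ^+ 2 + (p' * D) ^+ 2.
  have -> : (p' * c - p) ^+ 2 + (p' * D) ^+ 2
    = p' ^+ 2 * (c ^+ 2 + D ^+ 2) - 2 * c * p * p' + p ^+ 2 by ring.
  by rewrite cD /n; ring.
have nE' : n = (p' - c * p) ^+ 2 + (p * D) ^+ 2.
  have -> : (p' - c * p) ^+ 2 + (p * D) ^+ 2
    = p ^+ 2 * (c ^+ 2 + D ^+ 2) - 2 * c * p * p' + p' ^+ 2 by ring.
  by rewrite cD /n; ring.
have n0 : 0 < n.
  rewrite lt_neqAle eq_sym nE addr_ge0 ?sqr_ge0// andbT.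
  rewrite paddr_eq0 ?sqr_ge0// !sqrf_eq0 mulf_eq0 (negbTE D0) orbF.
  apply/negP => /andP[/eqP e /eqP p'0]; move: e D0.
  rewrite /D /det p'0 mul0r sub0r => /eqP; rewrite oppr_eq0 => /eqP ->.
  by rewrite !mul0r subr0 eqxx.
have v0 : 0 < D ^+ 2 / n by rewrite divr_gt0// exprn_even_gt0.
exists (point ((p' * q' + p * q - c * (p * q' + p' * q)) / n) (D ^+ 2 / n)).
rewrite /horo /= re_point// im_point//.
set u := _ / n; set v := D ^+ 2 / n.
have A : p * u - q = D * (p' - c * p) / n.
  rewrite /u /D /det [in RHS]/n; apply: (mulIf (x := n)); first by lra.
  by rewrite mulrBl mulrA !divfK ?gt_eqF// /n; ring.
have B : p' * u - q' = D * (c * p' - p) / n.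
  rewrite /u /D /det [in RHS]/n; apply: (mulIf (x := n)); first by lra.
  by rewrite mulrBl mulrA !divfK ?gt_eqF// /n; ring.
split.
- rewrite A /v.
  transitivity (D ^+ 2 * ((p' - c * p) ^+ 2 + (p * D) ^+ 2) / n ^+ 2).
    by field; lra.
  by rewrite -nE'; field; lra.
- rewrite B /v.
  transitivity (D ^+ 2 * ((p' * c - p) ^+ 2 + (p' * D) ^+ 2) / n ^+ 2).
    by field; lra.
  by rewrite -nE; field; lra.
rewrite A B /v.
transitivity (D ^+ 2 * (c * (p ^+ 2 + p' ^+ 2)
  + p * p' * ((c ^+ 2 + D ^+ 2) - 1 - 2 * c ^+ 2)) / n ^+ 2).
  by field; lra.
rewrite cD; transitivity (c * (D ^+ 2 * n / n ^+ 2)); last by field; lra.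
by rewrite [in D ^+ 2 * n]/n; field; lra.
Qed.

Lemma det0_scale p q p' q' : (p, q) != (0, 0) -> det p q p' q' = 0 ->
  exists t, p' = t * p /\ q' = t * q.
Proof.
move=> pq D0; have [p0|p0] := eqVneq p 0; last first.
  exists (p' / p); split; first by field.
  apply: (mulfI p0); move: D0; rewrite /det => /eqP; rewrite subr_eq0.
  by move/eqP->; field.
have q0 : q != 0 by apply: contraNneq pq => ->; rewrite p0.
exists (q' / q); split; last by field.
move/eqP: D0; rewrite /det p0 mul0r sub0r oppr_eq0 mulf_eq0 (negbTE q0) orbF.
by move/eqP->; rewrite mulr0.
Qed.

Lemma horo_scale (t : R) p q : t ^+ 2 = 1 -> horo (t * p) (t * q) = horo p q.
Proof.
move=> t1; apply/funext => z; rewrite /horo /=; congr (_ = _).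
by rewrite -mulrA -mulrBr -!mulrA !(exprMn _ t) t1 !mul1r.
Qed.

Lemma horo_neq0 p q z : horo p q z -> (p, q) != (0, 0).
Proof.
move=> hz; apply/eqP => -[p0 q0]; have := im_gt0 z.
by rewrite -hz p0 q0; lra.
Qed.

(** Distinct horocycles with the same center are disjoint. *)
Lemma concentric_meet p q p' q' z : det p q p' q' = 0 ->
  horo p q z -> horo p' q' z -> horo p q = horo p' q'.
Proof.
move=> D0 hz; have [t [-> ->]] := det0_scale (horo_neq0 hz) D0.
move=> kz; rewrite horo_scale//; have z0 := im_gt0 z.
apply: (mulIf (x := im z)); first by lra.
rewrite mul1r -[RHS]kz -[in LHS]hz; ring.
Qed.

Lemma horo_two_points p q : (p, q) != (0, 0) ->
  exists z w, [/\ z <> w, horo p q z & horo p q w].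
Proof.
move=> pq; have [p0|p0] := eqVneq p 0.
  have q2 : 0 < q ^+ 2.
    by rewrite exprn_even_gt0//=; apply: contraNneq pq => ->; rewrite p0.
  exists (point 0 (q ^+ 2)), (point 1 (q ^+ 2)).
  split; rewrite /horo /= ?im_point ?re_point// ?p0; try ring.
  by move/(congr1 re);
     rewrite !re_point// => /eqP; rewrite eq_sym oner_eq0.
have p2 : 0 < (p ^+ 2)^-1 by rewrite invr_gt0 exprn_even_gt0.
have p2' : 0 < (p ^+ 2)^-1 / 2 by lra.
exists (point (q / p) (p ^+ 2)^-1),
  (point (q / p + (p ^+ 2)^-1 / 2) ((p ^+ 2)^-1 / 2)).
split; rewrite /horo /= ?im_point ?re_point//; try by field.
by move/(congr1 im); rewrite !im_point//; lra.
Qed.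

(** The locus determines the direction of its vector. Three points suffice: on a
    circle, its top point and its two points at mid-height. *)
Lemma horo_eq_concentric p q p' q' :
  (p, q) != (0, 0) -> horo p q = horo p' q' -> det p q p' q' = 0.
Proof.
move=> pq E; apply/eqP/negPn/negP => D0.
have sub z : horo p q z -> horo p' q' z by rewrite E.
have [p0|p0] := eqVneq p 0.
  have q2 : 0 < q ^+ 2.
    by rewrite exprn_even_gt0//=; apply: contraNneq pq => ->; rewrite p0.
  have F x : (p' * x - q') ^+ 2 + (p' * q ^+ 2) ^+ 2 = q ^+ 2.
    have := sub (point x (q ^+ 2)); rewrite /horo /= re_point// im_point// p0.
    by apply; ring.
  have p'0 : p' = 0.
    have := F 0; have := F 1; have := F (-1) => e1 e2 e3.
    by apply/eqP; rewrite -sqrf_eq0; apply/eqP; lra.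
  by move: D0; rewrite /det p0 p'0 !mul0r subr0 eqxx.
have p2 : 0 < (p ^+ 2)^-1 by rewrite invr_gt0 exprn_even_gt0.
have p2' : 0 < (p ^+ 2)^-1 / 2 by lra.
set d := (p ^+ 2)^-1 in p2 p2'.
set s := p' * (q / p) - q'.
have sE : s = - det p q p' q' / p by rewrite /s /det; field.
have s0 : s != 0 by rewrite sE mulf_neq0 ?oppr_eq0 ?invr_eq0.
have top : s ^+ 2 + (p' * d) ^+ 2 = d.
  have := sub (point (q / p) d); rewrite /horo /= re_point// im_point//.
  by apply; rewrite /d; field.
have rgt : (s + p' * d / 2) ^+ 2 + (p' * (d / 2)) ^+ 2 = d / 2.
  have := sub (point (q / p + d / 2) (d / 2)).
  rewrite /horo /= re_point// im_point//.
  have -> : p' * (q / p + d / 2) - q' = s + p' * d / 2 by rewrite /s; ring.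
  by apply; rewrite /d; field.
have lft : (s - p' * d / 2) ^+ 2 + (p' * (d / 2)) ^+ 2 = d / 2.
  have := sub (point (q / p - d / 2) (d / 2)).
  rewrite /horo /= re_point// im_point//.
  have -> : p' * (q / p - d / 2) - q' = s - p' * d / 2 by rewrite /s; ring.
  by apply; rewrite /d; field.
have : s * (p' * d) = 0 by lra.
move/eqP; rewrite mulf_eq0 (negbTE s0) /= => /eqP p'd.
by move: top rgt; rewrite (mulrA p') p'd; lra.
Qed.

(** Common points of horocycles with D != 0 correspond to the solutions c of
    c^2 + D^2 = 1, and there is exactly one solution iff D^2 = 1. *)
Lemma tangentP p q p' q' : (p, q) != (0, 0) ->
  tangent (horo p q) (horo p' q') <-> det p q p' q' ^+ 2 = 1.
Proof.
move=> pq; split=> [[z zE]|D1].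
  have [hz kz] : (horo p q `&` horo p' q') z by rewrite zE.
  have zU w : horo p q w -> horo p' q' w -> w = z.
    by move=> hw kw; have : (horo p q `&` horo p' q') w by []; rewrite zE.
  have [D0|D0] := eqVneq (det p q p' q') 0.
    have hk := concentric_meet D0 hz kz.
    have [a [b [ab ha hb]]] := horo_two_points pq.
    have az : a = z by apply: zU; rewrite -?hk.
    have bz : b = z by apply: zU; rewrite -?hk.
    by case: ab; rewrite az bz.
  have [c [cD Sz _ _ _]] := common_pointE D0 hz kz.
  have [|w [hw kw]] := @common_point_exists p q p' q' (- c) D0.
    by rewrite sqrrN.
  rewrite (zU w)// Sz => cz; have z0 := im_gt0 z.
  have : c * im z = 0 by lra.
  move/eqP; rewrite mulf_eq0 (gt_eqF z0) orbF => /eqP c0.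
  by rewrite -cD c0; ring.
have D0 : det p q p' q' != 0.
  by apply: contra_eq_neq D1 => ->; rewrite expr0n/= eq_sym oner_eq0.
have [|z [hz kz _]] := @common_point_exists p q p' q' 0 D0.
  by rewrite D1 expr0n/= add0r.
exists z; apply/seteqP; split=> [w [hw kw]/=|w ->//].
have c0 c : c ^+ 2 + det p q p' q' ^+ 2 = 1 -> c = 0.
  by rewrite D1 => e; apply/eqP; rewrite -sqrf_eq0; apply/eqP; lra.
have [c [/c0 -> _ _ zu zv]] := common_pointE D0 hz kz.
have [c' [/c0 -> _ _ wu wv]] := common_pointE D0 hw kw.
by apply: H2_eq; rewrite ?zu ?wu ?zv ?wv.
Qed.

(** Two independent vectors u, v have a vector k with det(k, u) = det(k, v) = 1,
    found by solving a linear system; if v = t u, then a common tangent forces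
    t^2 = 1 and the horocycles coincide. *)
Lemma cotangentP p q p' q' :
  (p, q) != (0, 0) -> (p', q') != (0, 0) -> horo p q <> horo p' q' ->
  (exists k, [/\ horocycle k, tangent k (horo p q) & tangent k (horo p' q')])
  <-> det p q p' q' != 0.
Proof.
move=> pq pq' hk; split=> [[k []]|D0].
  move=> /horocycleP[a [b [ab ->]]].
  move=> /(tangentP _ _ ab) d1 /(tangentP _ _ ab) d2.
  apply/eqP => /(det0_scale pq) [t [pE qE]]; apply: hk.
  rewrite pE qE horo_scale// -d2 pE qE -[LHS]mulr1 -d1 /det; ring.
have kE1 : det ((p - p') / det p q p' q') ((q - q') / det p q p' q') p q = 1.
  by move: D0; rewrite /det => D0; field.
have kE2 : det ((p - p') / det p q p' q') ((q - q') / det p q p' q') p' q' = 1.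
  by move: D0; rewrite /det => D0; field.
have k0 : ((p - p') / det p q p' q', (q - q') / det p q p' q') != (0, 0).
  apply/eqP => -[e1 e2]; move: kE1; rewrite e1 e2 /det !mul0r mulr0 subr0.
  by move/eqP; rewrite eq_sym oner_eq0.
exists (horo ((p - p') / det p q p' q') ((q - q') / det p q p' q')); split.
- by apply/horocycleP; eexists; eexists; split; first exact: k0.
- by apply/tangentP => //; rewrite kE1 expr1n.
- by apply/tangentP => //; rewrite kE2 expr1n.
Qed.

(** The vectors (p, q) for which |p z - q|^2 / im z and |p w - q|^2 / im w agree
    are the isotropic vectors of a quadratic form. Its discriminant is
    im z * im w * |z - w|^2 > 0, so it vanishes on two lines; a suitable
    multiple of a vector of either line makes both quotients equal to 1. *)
Lemma horo_through_two z w : z <> w -> exists p q p' q',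
  [/\ det p q p' q' != 0, horo p q z /\ horo p q w
    & horo p' q' z /\ horo p' q' w].
Proof.
move=> zw; have z0 := im_gt0 z; have w0 := im_gt0 w.
pose Q p q (u : H2 R) := (p * re u - q) ^+ 2 + (p * im u) ^+ 2.
suff [p [q [p' [q' [D0 Fpq Fpq']]]]] : exists p q p' q',
    [/\ det p q p' q' != 0, im w * Q p q z = im z * Q p q w
      & im w * Q p' q' z = im z * Q p' q' w].
  have norm a b : (a, b) != (0, 0) -> im w * Q a b z = im z * Q a b w ->
      exists s, s != 0 /\ (horo (s * a) (s * b) z /\ horo (s * a) (s * b) w).
    move=> ab Fab.
    have Q0 : 0 < Q a b z.
      rewrite lt_neqAle eq_sym addr_ge0 ?sqr_ge0// andbT.
      rewrite paddr_eq0 ?sqr_ge0// !sqrf_eq0 mulf_eq0 (gt_eqF z0) orbF.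
      apply: contra ab => /andP[/eqP + /eqP a0].
      by rewrite a0 mul0r sub0r => /eqP; rewrite oppr_eq0 => /eqP ->.
    have s0 : 0 < im z / Q a b z by rewrite divr_gt0.
    have sE : Num.sqrt (im z / Q a b z) ^+ 2 = im z / Q a b z.
      by rewrite sqr_sqrtr// ltW.
    have s1 : 0 < Num.sqrt (im z / Q a b z) by rewrite sqrtr_gt0.
    set s := Num.sqrt _ in sE s1; exists s; split; first by rewrite gt_eqF.
    have hE u : horo (s * a) (s * b) u = (im z / Q a b z * Q a b u = im u).
      by rewrite -sE /horo /Q /=; congr (_ = _); ring.
    rewrite !hE divfK ?gt_eqF//; split=> //.
    by rewrite mulrAC -Fab mulfK ?gt_eqF.
  have [||s [s0 [sz sw]]] := norm p q => //.
    by apply: contraNneq D0 => -[-> ->]; rewrite /det !(mul0r, mulr0) subr0.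
  have [||t [t0 [tz tw]]] := norm p' q' => //.
    by apply: contraNneq D0 => -[-> ->]; rewrite /det !(mul0r, mulr0) subr0.
  exists (s * p), (s * q), (t * p'), (t * q'); split=> //.
  have -> : det (s * p) (s * q) (t * p') (t * q') = s * t * det p q p' q'.
    by rewrite /det; ring.
  by rewrite !mulf_neq0.
(* The form is al p^2 - 2 be p q + ga q^2. *)
pose al := (re z ^+ 2 + im z ^+ 2) * im w - (re w ^+ 2 + im w ^+ 2) * im z.
pose be := re z * im w - re w * im z.
pose ga := im w - im z.
have FE p q : al * p ^+ 2 - 2 * be * p * q + ga * q ^+ 2 = 0 ->
    im w * Q p q z = im z * Q p q w.
  by move=> e; apply/eqP; rewrite -subr_eq0; apply/eqP; rewrite -e
    /Q /al /be /ga; ring.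
have De : 0 < be ^+ 2 - al * ga.
  have -> : be ^+ 2 - al * ga =
      im z * im w * ((re z - re w) ^+ 2 + (im z - im w) ^+ 2).
    by rewrite /al /be /ga; ring.
  rewrite !mulr_gt0// lt_neqAle eq_sym addr_ge0 ?sqr_ge0// andbT.
  rewrite paddr_eq0 ?sqr_ge0// !sqrf_eq0 !subr_eq0.
  by apply/negP => /andP[/eqP e1 /eqP e2]; apply: zw; apply: H2_eq.
clearbody al be ga.
have [ga0|ga0] := eqVneq ga 0.
  have be0 : be != 0.
    by apply: contraTneq De => ->; rewrite ga0 mulr0 subr0 expr0n ltxx.
  exists 0, 1, (2 * be), al; split; last 2 first.
  - by apply: FE; rewrite ga0; ring.
  - by apply: FE; rewrite ga0; ring.
  by rewrite /det mul0r sub0r mulr1 oppr_eq0 mulf_neq0// pnatr_eq0.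
have dE : Num.sqrt (be ^+ 2 - al * ga) ^+ 2 = be ^+ 2 - al * ga.
  by rewrite sqr_sqrtr// ltW.
have d0 : 0 < Num.sqrt (be ^+ 2 - al * ga) by rewrite sqrtr_gt0.
set d := Num.sqrt _ in dE d0.
exists ga, (be + d), ga, (be - d); split.
- have -> : det ga (be + d) ga (be - d) = - (2 * (ga * d)).
    by rewrite /det; ring.
  by rewrite oppr_eq0 !mulf_neq0 ?pnatr_eq0// gt_eqF.
- apply: FE; transitivity (ga * (d ^+ 2 - be ^+ 2 + al * ga)); first by ring.
  by rewrite dE; ring.
- apply: FE; transitivity (ga * (d ^+ 2 - be ^+ 2 + al * ga)); first by ring.
  by rewrite dE; ring.
Qed.

(** Decompose the third vector as s (p, q) + t (p', q'). The points z and w are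
    the two common points, belonging to c and - c, so s^2 + t^2 + 2 s t c and
    s^2 + t^2 - 2 s t c are both 1. Hence s t = 0. *)
Lemma no_third_horo p q p' q' a b z w : z <> w -> det p q p' q' != 0 ->
  horo p q z -> horo p q w -> horo p' q' z -> horo p' q' w ->
  horo a b z -> horo a b w -> horo a b = horo p q \/ horo a b = horo p' q'.
Proof.
move=> zw D0 hz hw kz kw lz lw; have z0 := im_gt0 z; have w0 := im_gt0 w.
have [c [cD Sz _ zu zv]] := common_pointE D0 hz kz.
have [d [dD Sw _ wu wv]] := common_pointE D0 hw kw.
have cd : c != d.
  by apply/eqP => cd; apply: zw; apply: H2_eq; rewrite ?zu ?wu ?zv ?wv cd.
have dE : d = - c.
  have : (d - c) * (d + c) = 0 by lra.
  move/eqP; rewrite mulf_eq0 subr_eq0 eq_sym (negbTE cd) /= addr_eq0.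
  by move/eqP.
have c0 : c != 0 by apply: contraNneq cd => e; rewrite dE e oppr0.
pose s := det a b p' q' / det p q p' q'.
pose t := det p q a b / det p q p' q'.
have aE : a = s * p + t * p' by move: D0; rewrite /s /t /det => D0; field.
have bE : b = s * q + t * q' by move: D0; rewrite /s /t /det => D0; field.
have norm e u : im u > 0 -> horo p q u -> horo p' q' u -> horo a b u ->
    (p * re u - q) * (p' * re u - q') + p * p' * im u ^+ 2 = e * im u ->
    s ^+ 2 + t ^+ 2 + 2 * s * t * e = 1.
  rewrite /horo /= => u0 hu ku lu Su; apply: (mulIf (x := im u)).
    by rewrite gt_eqF.
  transitivity (s ^+ 2 * im u + t ^+ 2 * im u + 2 * s * t * (e * im u)).
    by ring.
  rewrite mul1r -Su -[RHS]lu.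
  rewrite -[X in s ^+ 2 * X + _]hu -[X in _ + t ^+ 2 * X + _]ku.
  by rewrite aE bE; ring.
have e1 := norm _ _ z0 hz kz lz Sz.
have e2 := norm _ _ w0 hw kw lw Sw.
have : s * t * c = 0 by move: e1 e2; rewrite dE; lra.
move/eqP; rewrite mulf_eq0 (negbTE c0) orbF mulf_eq0.
case/orP=> /eqP st0; [right|left]; rewrite aE bE st0 !mul0r ?add0r ?addr0.
- apply: horo_scale; move: e1; rewrite st0; lra.
- apply: horo_scale; move: e1; rewrite st0; lra.
Qed.

(** * Inversions *)

(** Reflection in the geodesic from t - 1 to t + 1; it exchanges the boundary
    point t with infinity. *)
Definition inversion (t : R) z : H2 R :=
  let n := (re z - t) ^+ 2 + im z ^+ 2 in
  point (t + (re z - t) / n) (im z / n).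

Section Inversion.
Variable t : R.

Let n z := (re z - t) ^+ 2 + im z ^+ 2.

Let n_gt0 z : 0 < n z.
Proof.
rewrite lt_neqAle eq_sym addr_ge0 ?sqr_ge0// andbT.
by rewrite paddr_eq0 ?sqr_ge0// negb_and !sqrf_eq0 (gt_eqF (im_gt0 z)) orbT.
Qed.

Lemma re_inversion z : re (inversion t z) = t + (re z - t) / n z.
Proof. by rewrite re_point// divr_gt0 ?im_gt0 ?n_gt0. Qed.

Lemma im_inversion z : im (inversion t z) = im z / n z.
Proof. by rewrite im_point// divr_gt0 ?im_gt0 ?n_gt0. Qed.

Lemma inversionK : involutive (inversion t).
Proof.
move=> z; have n0 := n_gt0 z.
have nn : n (inversion t z) = (n z)^-1.
  rewrite {1}/n re_inversion im_inversion.
  transitivity (((re z - t) ^+ 2 + im z ^+ 2) / n z ^+ 2).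
    by field; rewrite gt_eqF.
  by rewrite -/(n z); field; rewrite gt_eqF.
by apply: H2_eq; rewrite ?re_inversion ?im_inversion nn; field; rewrite gt_eqF.
Qed.

Lemma hdist_inversion z w : hdist (inversion t z) (inversion t w) = hdist z w.
Proof.
rewrite !hdistE !re_inversion !im_inversion.
have nz := n_gt0 z; have nw := n_gt0 w.
have z0 := im_gt0 z; have w0 := im_gt0 w.
congr (arcosh (1 + _)).
move: nz nw z0 w0; rewrite /n.
move: (re z) (re w) (im z) (im w) => a b c d nz nw z0 w0.
field; by rewrite !gt_eqF.
Qed.

Lemma image_inversion_horo p q :
  inversion t @` horo p q = horo (p * t - q) ((p * t - q) * t - p).
Proof.
have E z : horo (p * t - q) ((p * t - q) * t - p) (inversion t z)
    <-> horo p q z.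
  rewrite /horo /= re_inversion im_inversion.
  have n0 := n_gt0 z.
  set s := p * t - q.
  have -> : (s * (t + (re z - t) / n z) - (s * t - p)) ^+ 2
      + (s * (im z / n z)) ^+ 2 =
      ((p * re z - q) ^+ 2 + (p * im z) ^+ 2) / n z.
    transitivity ((s ^+ 2 * n z + 2 * s * p * (re z - t) * n z
       + p ^+ 2 * n z ^+ 2) / n z ^+ 2).
      rewrite [in s ^+ 2 * n z]/n; field; by rewrite gt_eqF.
    transitivity ((s ^+ 2 + 2 * s * p * (re z - t) + p ^+ 2 * n z) / n z).
      by field; rewrite gt_eqF.
    by congr (_ / _); rewrite /n /s; ring.
  by split=> [/(mulIf _)|->//]; apply; rewrite invr_eq0 gt_eqF.
apply/seteqP; split=> [_ [z hz <-]|z hz]; first exact/E.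
by exists (inversion t z); [apply/E; rewrite inversionK|rewrite inversionK].
Qed.

Lemma inversion_horocycle h : horocycle h -> horocycle (inversion t @` h).
Proof.
move=> /horocycleP[p [q [pq ->]]]; rewrite image_inversion_horo.
apply/horocycleP; do 2 eexists; split; last by [].
apply: contraNneq pq => -[/eqP]; rewrite subr_eq0 => /eqP <-.
by rewrite subrr mul0r sub0r => /eqP;
   rewrite oppr_eq0 => /eqP ->; rewrite mul0r.
Qed.

End Inversion.

(** * A functional equation *)

(** Expanding the hypothesis at x, x + 1 and x - 1 excludes
    G (x^2) = - (G x)^2 unless G x = 0, so G commutes with squaring, preserves
    the order, and agrees with the identity on integers. Thus G x - x is bounded
    by 1, and being additive it vanishes. *)
Lemma additive_sqr_id (G : R -> R) :
  {morph G : x y / x + y} -> G 1 = 1 ->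
  (forall x, G (x ^+ 2) ^+ 2 = (G x ^+ 2) ^+ 2) -> forall x, G x = x.
Proof.
move=> GD G1 Gsq.
have G0 : G 0 = 0 by have := GD 0 0; rewrite addr0; lra.
have GN x : G (- x) = - G x by have := GD x (- x); rewrite subrr G0; lra.
have GMn x n : G (x *+ n) = G x *+ n.
  by elim: n => [|n IHn]; rewrite ?mulr0n// !mulrS GD IHn.
have Gz (m : int) : G m%:~R = m%:~R.
  case: m => n; first by rewrite -pmulrn GMn G1.
  by rewrite NegzE mulrNz GN -pmulrn GMn G1.
have GX x : G (x ^+ 2) = G x ^+ 2.
  have : (G (x ^+ 2) - G x ^+ 2) * (G (x ^+ 2) + G x ^+ 2) = 0.
    by have := Gsq x; lra.
  move/eqP; rewrite mulf_eq0 => /orP[/eqP|/eqP] e; first by lra.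
  have Gp : G ((x + 1) ^+ 2) = - G x ^+ 2 + 2 * G x + 1.
    have -> : (x + 1) ^+ 2 = x ^+ 2 + x + x + 1 by ring.
    by rewrite !GD G1; lra.
  have Gm : G ((x - 1) ^+ 2) = - G x ^+ 2 - 2 * G x + 1.
    have -> : (x - 1) ^+ 2 = x ^+ 2 + (- x) + (- x) + 1 by ring.
    by rewrite !GD !GN G1; lra.
  have := Gsq (x + 1); have := Gsq (x - 1).
  rewrite Gp Gm !GD GN G1; move: (G x) e => a e e1 e2.
  have {}e1 : a ^+ 2 * (1 - 2 * a) = 0 by lra.
  have {}e2 : a ^+ 2 * (1 + 2 * a) = 0 by lra.
  by lra.
have G_ge0 x : 0 <= x -> 0 <= G x.
  by move=> x0; rewrite -(sqr_sqrtr x0) GX sqr_ge0.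
have G_homo x y : x <= y -> G x <= G y.
  by move=> xy; rewrite -subr_ge0 -GN -GD G_ge0// subr_ge0.
have near x : `|G x - x| <= 1.
  have /andP[l u] := floor_itv x.
  have := G_homo _ _ l; have := G_homo _ _ (ltW u); rewrite !Gz.
  move: l u; rewrite intrD => l u a b.
  by rewrite ler_norml; apply/andP; split; lra.
move=> x; apply/eqP; rewrite -subr_eq0 -normr_eq0 eq_le normr_ge0 andbT leNgt.
apply/negP => e0.
pose n := Num.bound (`|G x - x|^-1).
have nP : `|G x - x|^-1 < n%:R.
  by apply: archi_boundP; rewrite invr_ge0 ltW.
have := near (x *+ n); rewrite GMn -mulrnBl normrMn leNgt => /negP; apply.
by rewrite -mulr_natr -ltr_pdivrMl// mulr1.
Qed.

(** For x, x + t, x + 2t the images of consecutive points are at the same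
    distance psi |t|, and those of the extreme points differ; so phi preserves
    midpoints and g = phi - phi 0 is additive. With x' = 0, the pairs
    (d, d') = (|x|, |x|) and (x^2, 1) give (g x)^2 = psi(|x|)^2 and
    (g x)^2 = psi(x^2) psi(1). Hence g / g 1 commutes with squaring up to
    sign. *)
Lemma scaling_distances_affine (phi psi : R -> R) :
  (forall d, 0 < d -> 0 < psi d) ->
  (forall x x' d d', 0 < d -> 0 < d' -> (x - x') ^+ 2 = d * d' ->
     (phi x - phi x') ^+ 2 = psi d * psi d') ->
  exists a b, [/\ a != 0, forall x, phi x = a * x + b
    & forall d, 0 < d -> psi d = `|a| * d].
Proof.
move=> psi0 E.
have step x t : t != 0 ->
    phi (x + t + t) - phi (x + t) = phi (x + t) - phi x.
  move=> t0; have t1 : 0 < `|t| by rewrite normr_gt0.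
  have tt : t ^+ 2 = `|t| * `|t| by rewrite -expr2 real_normK ?num_real.
  have e1 : (phi (x + t + t) - phi (x + t)) ^+ 2 = psi `|t| * psi `|t|.
    by apply: E => //; rewrite -tt; ring.
  have e2 : (phi (x + t) - phi x) ^+ 2 = psi `|t| * psi `|t|.
    by apply: E => //; rewrite -tt; ring.
  have e3 : (phi (x + t + t) - phi x) ^+ 2 = psi (2 * `|t|) * psi (2 * `|t|).
    apply: E; rewrite ?mulr_gt0//.
    by transitivity (4 * t ^+ 2); [ring|rewrite tt; ring].
  have p0 : 0 < psi (2 * `|t|) * psi (2 * `|t|).
    by rewrite mulr_gt0// psi0// mulr_gt0.
  have d0 : phi (x + t + t) - phi x != 0.
    by apply: contraTneq p0 => e; rewrite -e3 e expr0n ltxx.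
  by apply: (mulfI d0); lra.
pose g x := phi x - phi 0.
have g0 : g 0 = 0 by rewrite /g subrr.
have g2 t : g (t + t) = 2 * g t.
  have [->|t0] := eqVneq t 0; first by rewrite addr0 g0; ring.
  by have := step 0 t t0; rewrite /g !add0r; lra.
have gD x y : g (x + y) = g x + g y.
  have [->|xy] := eqVneq x y; first by rewrite g2; ring.
  pose t := (y - x) / 2.
  have t0 : t != 0 by rewrite mulf_neq0 ?invr_eq0 ?pnatr_eq0// subr_eq0 eq_sym.
  have := step x t t0; have -> : x + t + t = y by rewrite /t; field.
  have := g2 (x + t); have -> : x + t + (x + t) = x + y by rewrite /t; field.
  by rewrite /g; lra.
have sqE x : x != 0 -> g x ^+ 2 = psi `|x| ^+ 2.
  move=> x0; rewrite expr2; apply: E; rewrite ?normr_gt0//.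
  by rewrite subr0 -expr2 real_normK ?num_real.
have sqE1 x : x != 0 -> g x ^+ 2 = psi (x ^+ 2) * psi 1.
  move=> x0; apply: E => //; first by rewrite exprn_even_gt0.
  by rewrite subr0 mulr1.
have p1 := psi0 1 ltr01.
have g1 : g 1 ^+ 2 = psi 1 ^+ 2 by rewrite (sqE _ (oner_neq0 R)) normr1.
have g10 : g 1 != 0 by rewrite -sqrf_eq0 g1 sqrf_eq0 gt_eqF.
have gE x : g x / g 1 = x.
  apply: (additive_sqr_id (G := fun x => g x / g 1)) => [y z||y].
  - by rewrite gD mulrDl.
  - by rewrite divff.
  have [->|y0] := eqVneq y 0; first by rewrite expr0n/= g0 !mul0r; ring.
  have y2 : y ^+ 2 != 0 by rewrite sqrf_eq0.
  rewrite !expr_div_n g1 (sqE _ y2) (sqE1 _ y0) ger0_norm ?sqr_ge0//.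
  by field; lra.
exists (g 1), (phi 0); split=> // [x|d d0].
  have -> : g 1 * x = g x by rewrite -[in LHS](gE x); field.
  by rewrite /g; lra.
have gd : g d = g 1 * d by rewrite -[in RHS](gE d); field.
have := sqE d; rewrite gt_eqF// gd ger0_norm ?(ltW d0)// => /(_ isT) e.
apply/eqP; rewrite -(@eqrXn2 _ 2%N)// ?(ltW (psi0 _ d0))//; last first.
  by rewrite mulr_ge0// ltW.
by rewrite -e !exprMn real_normK ?num_real.
Qed.

(** * Bijections preserving horocycles *)

Lemma tangent_image (f : H2 R -> H2 R) h k : injective f ->
  tangent (f @` h) (f @` k) <-> tangent h k.
Proof.
move=> f_inj; split=> -[z zE].
  have [[u hu fu] [v kv fv]] : (f @` h `&` f @` k) z by rewrite zE.
  have uv : u = v by apply: f_inj; rewrite fu.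
  exists u; apply/seteqP; split=> [w [hw kw]/=|_ ->].
  2: by split=> //; rewrite uv.
  have : (f @` h `&` f @` k) (f w) by split; exists w.
  by rewrite zE /= -fu => /f_inj.
have [hz kz] : (h `&` k) z by rewrite zE.
exists (f z); apply/seteqP; split=> [_ [[u hu <-] [v kv /f_inj vu]]/=|_ ->].
  by have : (h `&` k) u by [split=> //; rewrite -vu]; rewrite zE => ->.
by split; exists z.
Qed.

Section HorocyclePreserving.
Variable f : H2 R -> H2 R.
Hypotheses (f_bij : bijective f)
  (f_horo : forall h, horocycle h -> horocycle (f @` h)).

Let f_inj : injective f := bij_inj f_bij.

Let image_f_inj h k : f @` h = f @` k -> h = k.
Proof.
move=> E; apply/seteqP; split=> z hz.
  have : (f @` k) (f z) by rewrite -E; exists z.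
  by case=> w kw /f_inj <-.
have : (f @` h) (f z) by rewrite E; exists z.
by case=> w kw /f_inj <-.
Qed.

(** Two distinct points of k have preimages on two horocycles, whose images are
    the two horocycles through these points; k is one of the two. *)
Lemma horocycle_preimage k :
  horocycle k -> exists h, horocycle h /\ f @` h = k.
Proof.
move=> /horocycleP[a [b [ab ->]]].
have [z [w [zw lz lw]]] := horo_two_points ab.
case: f_bij => g fK gK.
have gzw : g z <> g w by move/(congr1 f); rewrite !gK.
have [p [q [p' [q' [D0 [hz hw] [kz kw]]]]]] := horo_through_two gzw.
have H : horocycle (horo p q).
  by apply/horocycleP; exists p, q; split=> //; exact: horo_neq0 hz.
have K : horocycle (horo p' q').
  by apply/horocycleP; exists p', q'; split=> //; exact: horo_neq0 kz.
have [c [d [cd cdE]]] := (horocycleP _).1 (f_horo H).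
have [c' [d' [cd' cdE']]] := (horocycleP _).1 (f_horo K).
have D1 : det c d c' d' != 0.
  apply: contra_neq D0 => D0; apply: (horo_eq_concentric (horo_neq0 hz)).
  apply: image_f_inj; rewrite cdE cdE'; apply: (concentric_meet (z := z)) => //.
    by rewrite -cdE; exists (g z).
  by rewrite -cdE'; exists (g z).
have [||||E|E] := no_third_horo zw D1 _ _ _ _ lz lw.
- by rewrite -cdE; exists (g z).
- by rewrite -cdE; exists (g w).
- by rewrite -cdE'; exists (g z).
- by rewrite -cdE'; exists (g w).
- by exists (horo p q); rewrite E.
- by exists (horo p' q'); rewrite E.
Qed.

(** A common tangent of the images would pull back, by [horocycle_preimage], to
    a common tangent of two concentric horocycles. *)
Lemma concentric_image p q p' q' a b a' b' :
  (p, q) != (0, 0) -> (p', q') != (0, 0) ->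
  (a, b) != (0, 0) -> (a', b') != (0, 0) ->
  f @` horo p q = horo a b -> f @` horo p' q' = horo a' b' ->
  det p q p' q' = 0 -> det a b a' b' = 0.
Proof.
move=> pq pq' ab ab' E E' D0.
have [hk|hk] := pselect (horo p q = horo p' q').
  by apply: (horo_eq_concentric ab); rewrite -E -E' hk.
have fhk : horo a b <> horo a' b' by rewrite -E -E' => /image_f_inj.
apply/eqP/negPn/negP => /(cotangentP ab ab' fhk) [k [k_horo]].
have [l [l_horo <-]] := horocycle_preimage k_horo.
rewrite -E -E' => /(tangent_image _ _ f_inj) t1 /(tangent_image _ _ f_inj) t2.
have : det p q p' q' != 0 by apply/(cotangentP pq pq' hk); exists l.
by rewrite D0 eqxx.
Qed.

Section FixInfinity.
Variable c : R.
Hypothesis f_infty : f @` horo 0 1 = horo 0 c.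

Let c_neq0 : c != 0.
Proof.
have := im_gt0 (f (point 0 1)).
have : horo 0 c (f (point 0 1)).
  by rewrite -f_infty; exists (point 0 1) => //;
     rewrite /horo /= im_point// re_point//; ring.
rewrite /horo /= => <-; apply: contraTneq => ->.
rewrite !mul0r subrr expr0n/= addr0.
by rewrite ltxx.
Qed.

Let psi d := im (f (point 0 d)).

Let psi_gt0 d : 0 < psi d. Proof. exact: im_gt0. Qed.

Let image_horizontal d : 0 < d ->
  exists e, e ^+ 2 = psi d /\ f @` horo 0 (Num.sqrt d) = horo 0 e.
Proof.
move=> d0; have s0 : 0 < Num.sqrt d by rewrite sqrtr_gt0.
have sd : (0 : R, Num.sqrt d) != (0, 0).
  by apply/eqP => -[e]; move: s0; rewrite e ltxx.
have h_horo : horocycle (horo 0 (Num.sqrt d)).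
  by apply/horocycleP; exists 0, (Num.sqrt d).
have [a [b [ab abE]]] := (horocycleP _).1 (f_horo h_horo).
have /eqP : det 0 c a b = 0.
  apply: (concentric_image _ sd _ ab f_infty abE); last by rewrite /det; ring.
  - by apply/eqP => -[/eqP]; rewrite oner_eq0.
  - by apply: contraNneq c_neq0 => -[->].
rewrite /det mul0r sub0r oppr_eq0 mulf_eq0 (negbTE c_neq0) orbF => /eqP a0.
exists b; split; last by rewrite abE a0.
have : horo a b (f (point 0 d)).
  rewrite -abE; exists (point 0 d) => //.
  by rewrite /horo /= re_point// im_point// !mul0r sub0r sqrrN
    sqr_sqrtr ?ltW//; ring.
by rewrite /horo /psi /= a0 => <-; ring.
Qed.

Let im_f z : im (f z) = psi (im z).
Proof.
have z0 := im_gt0 z.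
have [e [<- E]] := image_horizontal z0.
have : horo 0 e (f z).
  rewrite -E; exists z => //.
  by rewrite /horo /= !mul0r sub0r sqrrN sqr_sqrtr ?ltW//; ring.
by rewrite /horo /= => <-; ring.
Qed.

(** The circle of center x and diameter d is tangent to the horizontal line at
    height d, at its top point x + i d. Its image is tangent to the horizontal
    line at height psi d, hence has diameter psi d and is centered below the
    image of the top point. *)
Let image_circle0 x d : 0 < d -> exists a, a ^+ 2 * psi d = 1 /\
  f @` horo (Num.sqrt d)^-1 (x / Num.sqrt d) = horo a (a * re (f (point x d))).
Proof.
move=> d0; have s0 : 0 < Num.sqrt d by rewrite sqrtr_gt0.
have sE : Num.sqrt d ^+ 2 = d by rewrite sqr_sqrtr// ltW.
set s := Num.sqrt d in s0 sE.
have pq : (s^-1, x / s) != (0, 0).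
  by apply/eqP => -[/eqP]; rewrite invr_eq0 gt_eqF.
have h_horo : horocycle (horo s^-1 (x / s)).
  by apply/horocycleP; exists s^-1, (x / s).
have [a [b [ab abE]]] := (horocycleP _).1 (f_horo h_horo).
have [e [eE hE]] := image_horizontal d0.
have sd : (0 : R, s) != (0, 0) by apply/eqP => -[e0]; move: s0; rewrite e0 ltxx.
have ce : (0 : R, e) != (0, 0).
  by apply/eqP => -[e0]; have := psi_gt0 d; rewrite -eE e0 expr0n ltxx.
have : tangent (f @` horo 0 s) (f @` horo s^-1 (x / s)).
  apply/(tangent_image _ _ f_inj)/tangentP => //.
  by rewrite /det; field; rewrite gt_eqF.
rewrite hE abE => /(tangentP _ _ ce);
rewrite /det mul0r sub0r sqrrN exprMn eE => aE.
exists a; split=> //; congr horo.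
have : horo a b (f (point x d)).
  rewrite -abE; exists (point x d) => //.
  rewrite /horo /= re_point// im_point// -sE; field.
  by rewrite gt_eqF.
rewrite /horo /= im_f im_point// exprMn (expr2 (psi d)) mulrA aE mul1r => e0.
have : (a * re (f (point x d)) - b) ^+ 2 = 0 by lra.
by move/eqP; rewrite sqrf_eq0 subr_eq0 => /eqP.
Qed.

Let phi x := re (f (point x 1)).

(** Concentric circles have concentric images, so the real part of the image of
    x + i d does not depend on d. *)
Let image_circle x d : 0 < d -> exists a, a ^+ 2 * psi d = 1 /\
  f @` horo (Num.sqrt d)^-1 (x / Num.sqrt d) = horo a (a * phi x) /\
  re (f (point x d)) = phi x.
Proof.
move=> d0; have [a [aE hE]] := image_circle0 x d0.
have [b [bE kE]] := image_circle0 x ltr01.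
suff rE : re (f (point x d)) = phi x by exists a; split=> //; rewrite -rE.
have a0 : a != 0.
  by apply: contra_eq_neq aE => ->; rewrite expr0n mul0r eq_sym oner_eq0.
have b0 : b != 0.
  by apply: contra_eq_neq bE => ->; rewrite expr0n mul0r eq_sym oner_eq0.
have s0 e : 0 < e -> ((Num.sqrt e)^-1, x / Num.sqrt e) != (0, 0).
  by move=> e0; apply/eqP => -[/eqP]; rewrite invr_eq0 gt_eqF// sqrtr_gt0.
have /eqP : det a (a * re (f (point x d))) b (b * phi x) = 0.
  apply: concentric_image hE kE _; rewrite ?s0//.
  - by apply: contraNneq a0 => -[->].
  - by apply: contraNneq b0 => -[->].
  - by rewrite /det; ring.
have -> : det a (a * re (f (point x d))) b (b * phi x)
    = a * b * (phi x - re (f (point x d))) by rewrite /det; ring.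
by rewrite !mulf_eq0 (negbTE a0) (negbTE b0) /= subr_eq0 => /eqP ->.
Qed.

(** Tangent circles have tangent images, which is the hypothesis of
    [scaling_distances_affine] for the action phi on centers and the action psi
    on heights, so f (x + i y) = (a x + b) + i |a| y. *)
Lemma fix_infinity_hdist z w : hdist (f z) (f w) = hdist z w.
Proof.
have [a [b [a0 phiE psiE]]] : exists a b,
  [/\ a != 0, forall x, phi x = a * x + b
    & forall d, 0 < d -> psi d = `|a| * d].
  apply: scaling_distances_affine => // x x' d d' d0 d0' xd.
  have [a [aE [hE _]]] := image_circle x d0.
  have [a' [aE' [hE' _]]] := image_circle x' d0'.
  have s0 : 0 < Num.sqrt d by rewrite sqrtr_gt0.
  have s0' : 0 < Num.sqrt d' by rewrite sqrtr_gt0.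
  have sE : Num.sqrt d ^+ 2 = d by rewrite sqr_sqrtr// ltW.
  have sE' : Num.sqrt d' ^+ 2 = d' by rewrite sqr_sqrtr// ltW.
  have a0 : (a, a * phi x) != (0, 0).
    apply/eqP => -[e _]; move: aE; rewrite e expr0n mul0r => /eqP.
    by rewrite eq_sym oner_eq0.
  have : tangent (f @` horo (Num.sqrt d)^-1 (x / Num.sqrt d))
                 (f @` horo (Num.sqrt d')^-1 (x' / Num.sqrt d')).
    apply/(tangent_image _ _ f_inj)/tangentP.
      by apply/eqP => -[/eqP]; rewrite invr_eq0 gt_eqF.
    have -> : det (Num.sqrt d)^-1 (x / Num.sqrt d)
          (Num.sqrt d')^-1 (x' / Num.sqrt d')
        = (x' - x) / (Num.sqrt d * Num.sqrt d').
      by rewrite /det; field; rewrite !gt_eqF.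
    rewrite expr_div_n exprMn sE sE' -xd -sqrrN opprB divff// sqrf_eq0.
    by rewrite -sqrf_eq0 xd mulf_neq0// gt_eqF.
  rewrite hE hE' => /(tangentP _ _ a0) aa.
  transitivity ((a ^+ 2 * psi d) * (a' ^+ 2 * psi d') * (phi x - phi x') ^+ 2).
    by rewrite aE aE' !mul1r.
  transitivity (det a (a * phi x) a' (a' * phi x') ^+ 2 * (psi d * psi d')).
    by rewrite /det; ring.
  by rewrite aa mul1r.
have re_f u : re (f u) = a * re u + b.
  have u0 := im_gt0 u; have [_ [_ [_ E]]] := image_circle (re u) u0.
  have uE : u = point (re u) (im u).
    by apply: H2_eq; rewrite ?re_point ?im_point.
  by rewrite {1}uE E phiE.
have z0 := im_gt0 z; have w0 := im_gt0 w.
rewrite !hdistE !re_f !im_f !psiE ?im_gt0//; congr (arcosh (1 + _)).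
have a1 : `|a| != 0 by rewrite normr_eq0.
transitivity (`|a| ^+ 2 * ((re z - re w) ^+ 2 + (im z - im w) ^+ 2)
   / (`|a| ^+ 2 * (2 * im z * im w))); last by field; rewrite a1 !gt_eqF.
congr (_ / _); last by ring.
rewrite mulrDr -[in RHS](exprMn _ `|a| (im z - im w)) {1}real_normK ?num_real//.
by ring.
Qed.

End FixInfinity.
End HorocyclePreserving.
End HalfPlane.

Theorem theorem1 (R : realType) (f : H2 R -> H2 R)
    (f_bij : bijective f)
    (f_horo : forall h : set (H2 R), horocycle h -> horocycle (f @` h)) :
  H2_isometry f.
Proof.
split=> // z w.
have H01 : horocycle (horo 0 1 : set (H2 R)).
  apply/horocycleP; exists 0%R, 1%R; split=> //.
  by apply/eqP => -[/eqP]; rewrite GRing.oner_eq0.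
have [p [q [_ E]]] := (horocycleP _).1 (f_horo _ H01).
have [p0|p0] := eqVneq p 0%R.
  by apply: (fix_infinity_hdist f_bij f_horo (c := q)); rewrite E p0.
(* The inversion sends the center q / p of the image of a horizontal line to
   infinity: its vector becomes (0, - p). *)
pose t := (q / p)%R.
rewrite -(hdist_inversion t).
apply: (@fix_infinity_hdist _ (inversion t \o f) _ _ (- p)%R).
- exact: bij_comp (inv_bij (inversionK t)) f_bij.
- by move=> h /f_horo; rewrite -image_comp; exact: inversion_horocycle.
- rewrite -image_comp E image_inversion_horo.
  by have -> : (p * t - q = 0)%R;
    [rewrite /t; field|rewrite GRing.mul0r GRing.sub0r].
Qed.
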